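(* Let $(C,\psi_C)$ be a Coder pair. If $\mathrm{H}^2_{\mathrm{Coder}}(C,C)=0$, then $(C,\psi_C)$ is rigid, i.e. every 1-parameter formal deformation of $(C,\psi_C)$ is equivalent to the undeformed one $(\Delta,\psi_C)$, where $\Delta$ is the comultiplication of $C$.
   Context: Everything is over a field $\mathbb{F}$ of characteristic $0$ (vector spaces, linear maps, $\otimes$, $\mathrm{Hom}$). A coassociative coalgebra is a pair $(C,\Delta)$ with $C$ a vector space and $\Delta:C\to C\otimes C$ linear such that $(\mathrm{Id}_C\otimes\Delta)\circ\Delta=(\Delta\otimes\mathrm{Id}_C)\circ\Delta$. A coderivation of $C$ is a linear map $\psi_C:C\to C$ with $\Delta\circ\psi_C=(\psi_C\otimes\mathrm{Id}_C)\circ\Delta+(\mathrm{Id}_C\otimes\psi_C)\circ\Delta$. A Coder pair $(C,\psi_C)$ is a coassociative coalgebra $C$ with a coderivation $\psi_C$. Cochain complex of $(C,\psi_C)$ with coefficients in itself (the coadjoint bicomodule): for $n\ge 0$ let $C_c^n(C,C)=\mathrm{Hom}(C,C^{\otimes n})$ and, for $f\in C_c^n(C,C)$, $$\delta_c(f)=(\mathrm{Id}_C\otimes f)\circ\Delta+\sum_{i=1}^n(-1)^i(\mathrm{Id}_{C^{\otimes(i-1)}}\otimes\Delta\otimes\mathrm{Id}_{C^{\otimes(n-i)}})\circ f+(-1)^{n+1}(f\otimes\mathrm{Id}_C)\circ\Delta\in C_c^{n+1}(C,C).$$ For $n\ge1$ let $\omega:C_c^n(C,C)\to C_c^n(C,C)$,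 $\omega(f)=\sum_{i=1}^n(\mathrm{Id}_{C^{\otimes(i-1)}}\otimes\psi_C\otimes\mathrm{Id}_{C^{\otimes(n-i)}})\circ f-f\circ\psi_C$. Set $C^0_{\mathrm{Coder}}(C,C)=0$, $C^1_{\mathrm{Coder}}(C,C)=\mathrm{Hom}(C,C)$, and $C^n_{\mathrm{Coder}}(C,C)=C_c^n(C,C)\times C_c^{n-1}(C,C)$ for $n\ge2$, with differential $d_c^1(f)=(\delta_c(f),-\omega(f))$ and $d_c^n(f,g)=(\delta_c(f),\delta_c(g)+(-1)^n\omega(f))$ for $n\ge2$. This is a cochain complex, and $\mathrm{H}^n_{\mathrm{Coder}}(C,C)$ is its $n$-th cohomology group ($n$-cocycles $\ker d_c^n$ modulo $n$-coboundaries $\operatorname{im} d_c^{n-1}$). A 1-parameter formal deformation of $(C,\psi_C)$ is a pair $(\Delta_t,\psi_t)$ of formal power series $\Delta_t=\sum_{i\ge0}\Delta_it^i$, $\psi_t=\sum_{i\ge0}\psi_it^i$ with $\Delta_i\in\mathrm{Hom}(C,C^{\otimes2})$, $\psi_i\in\mathrm{Hom}(C,C)$, $\Delta_0=\Delta$, $\psi_0=\psi_C$, satisfying $(\mathrm{Id}_C\otimes\Delta_t)\circ\Delta_t=(\Delta_t\otimes\mathrm{Id}_C)\circ\Delta_t$ and $\Delta_t\circ\psi_t=(\psi_t\otimes\mathrm{Id}_C)\circ\Delta_t+(\mathrm{Id}_C\otimes\psi_t)\circ\Delta_t$ (equalities of formal power series, i.e. coefficientwise in $t$). Two 1-parameter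 formal deformations $(\Delta_t,\psi_t)$ and $(\overline\Delta_t,\overline\psi_t)$ of $(C,\psi_C)$ are equivalent if there is a power series $\Phi_t=\sum_{i\ge0}\phi_it^i$ with $\phi_i\in\mathrm{Hom}(C,C)$, $\phi_0=\mathrm{Id}_C$ (a formal automorphism), such that $\overline\Delta_t\circ\Phi_t=(\Phi_t\otimes\Phi_t)\circ\Delta_t$ and $\overline\psi_t\circ\Phi_t=\Phi_t\circ\psi_t$ (coefficientwise in $t$). A deformation is trivial if it is equivalent to $(\Delta,\psi_C)$; $(C,\psi_C)$ is rigid if every 1-parameter formal deformation of it is trivial. *)

(* Defs.v *)
From HB Require Import structures.
From mathcomp Require Import all_boot all_order all_algebra ring_quotient.
From mathcomp Require Import all_classical.
From mathcomp Require Import prodnormedzmodule.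
From mathcomp Require Import freeg.

Set Implicit Arguments.
Unset Strict Implicit.
Unset Printing Implicit Defensive.

Import GRing.Theory.
Local Open Scope ring_scope.
Local Open Scope quotient_scope.

Section Hom.
Variables (F : fieldType) (U V : lmodType F).
Implicit Types f g h : {linear U -> V}.

Lemma linext f g : f =1 g -> f = g.
Proof.
case: f g => [f [[Df] [Lf]]] [g [[Dg] [Lg]]] /= /funext efg.
subst g; congr GRing.Linear.Pack.
by congr GRing.Linear.Class;
  [congr GRing.isNmodMorphism.Axioms_ | congr GRing.isScalable.Axioms_];
  exact: Prop_irrelevance.
Qed.

Definition hom0 : {linear U -> V} := \0.
Definition homN f : {linear U -> V} := \- f.
Definition homD f g : {linear U -> V} := f \+ g.
Definition homZ a f : {linear U -> V} := a \*: f.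

Lemma homDA : associative homD.
Proof. by move=> f g h; apply: linext => x; exact: addrA. Qed.
Lemma homDC : commutative homD.
Proof. by move=> f g; apply: linext => x; exact: addrC. Qed.
Lemma hom0D : left_id hom0 homD.
Proof. by move=> f; apply: linext => x; exact: add0r. Qed.
Lemma homND : left_inverse hom0 homN homD.
Proof. by move=> f; apply: linext => x; exact: addNr. Qed.

HB.instance Definition _ :=
  GRing.isZmodule.Build {linear U -> V} homDA homDC hom0D homND.

Lemma homZA a b f : homZ a (homZ b f) = homZ (a * b) f.
Proof. by apply: linext => x; exact: scalerA. Qed.
Lemma hom1Z : left_id 1 homZ.
Proof. by move=> f; apply: linext => x; exact: scale1r. Qed.
Lemma homZDr : right_distributive homZ +%R.
Proof. by move=> a f g; apply: linext => x; exact: scalerDr. Qed.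
Lemma homZDl f : {morph homZ^~ f : a b / a + b}.
Proof. by move=> a b; apply: linext => x; exact: scalerDl. Qed.

HB.instance Definition _ :=
  GRing.Zmodule_isLmodule.Build F {linear U -> V} homZA hom1Z homZDr homZDl.

Lemma hom0E x : (0 : {linear U -> V}) x = 0. Proof. by []. Qed.
Lemma homDE f g x : (f + g) x = f x + g x. Proof. by []. Qed.
Lemma homNE f x : (- f) x = - f x. Proof. by []. Qed.
Lemma homZE a f x : (a *: f) x = a *: f x. Proof. by []. Qed.
Lemma hom_sumE (I : Type) (r : seq I) (P : pred I) (G : I -> {linear U -> V}) x :
  (\sum_(i <- r | P i) G i) x = \sum_(i <- r | P i) G i x.
Proof. by elim/big_rec2: _ => // i y1 y2 _ <-. Qed.

End Hom.

Definition Hom (F : fieldType) (U V : lmodType F) : lmodType F :=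
  {linear U -> V}.

Definition idl (F : fieldType) (U : lmodType F) : {linear U -> U} := idfun.

Definition compl (F : fieldType) (U V W : lmodType F)
  (g : {linear V -> W}) (f : {linear U -> V}) : {linear U -> W} := g \o f.

Notation "g \ol f" := (compl g f) (at level 40, left associativity).

Section CompLinear.
Variables (F : fieldType) (U V W : lmodType F).

Lemma complPl a (g g' : {linear V -> W}) (f : {linear U -> V}) :
  (a *: g + g') \ol f = a *: (g \ol f) + g' \ol f.
Proof. exact: linext. Qed.

Lemma complPr a (g : {linear V -> W}) (f f' : {linear U -> V}) :
  g \ol (a *: f + f') = a *: (g \ol f) + g \ol f'.
Proof. by apply: linext => x; exact: linearP. Qed.

End CompLinear.

Section LinBuild.
Variables (F : fieldType) (U V : lmodType F) (f : U -> V).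
Hypothesis lin_f : linear f.
Definition mklin_fun := f.
HB.instance Definition _ := GRing.isLinear.Build F U V *:%R mklin_fun lin_f.
Definition mklin : {linear U -> V} := mklin_fun.
Lemma mklinE x : mklin x = f x. Proof. by []. Qed.
End LinBuild.

Section LinQuotient.
Variables (F : fieldType) (V : lmodType F) (S : submodClosed V).

(* [submodClosed] does not carry the closure under opposite. *)
Definition lquot_pred : {pred V} := S.
HB.instance Definition _ :=
  GRing.isSubmodClosed.Build F V lquot_pred (GRing.submod_closed_semi (submodClosedP S)).
Local Notation quot := (ring_quotient.Quotient.quot lquot_pred).

Definition lquot := quot.

HB.instance Definition _ := GRing.Zmodule.on lquot.

Definition lpi_fun (x : V) : lquot := \pi_quot x.

Lemma lpi_eqP x y : lpi_fun x = lpi_fun y <-> x - y \in S.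
Proof.
by split=> [/eqP|h]; [|apply/eqP]; rewrite -ring_quotient.Quotient.idealrBE.
Qed.

Lemma lpi_funK (y : lquot) : lpi_fun (repr y) = y.
Proof. exact: reprK. Qed.

Lemma lpi_funD x y : lpi_fun (x + y) = lpi_fun x + lpi_fun y.
Proof. exact: (raddfD (\pi_quot)). Qed.

Definition lquot_scale (a : F) (x : lquot) : lquot := lpi_fun (a *: repr x).

Lemma lpi_funZ a x : lpi_fun (a *: x) = lquot_scale a (lpi_fun x).
Proof.
apply/lpi_eqP; rewrite -scalerBr; apply: rpredZ.
by apply/lpi_eqP; rewrite lpi_funK.
Qed.

Lemma lquot_scaleA a b x :
  lquot_scale a (lquot_scale b x) = lquot_scale (a * b) x.
Proof. by rewrite -(lpi_funK x) -!lpi_funZ scalerA. Qed.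
Lemma lquot_scale1 : left_id 1 lquot_scale.
Proof. by move=> x; rewrite -{1}(lpi_funK x) -lpi_funZ scale1r lpi_funK. Qed.
Lemma lquot_scaleDr : right_distributive lquot_scale +%R.
Proof.
move=> a x y; rewrite -(lpi_funK x) -(lpi_funK y) -lpi_funD -!lpi_funZ.
by rewrite -lpi_funD scalerDr.
Qed.
Lemma lquot_scaleDl x : {morph lquot_scale^~ x : a b / a + b}.
Proof.
by move=> a b; rewrite -(lpi_funK x) -!lpi_funZ -lpi_funD scalerDl.
Qed.

HB.instance Definition _ := GRing.Zmodule_isLmodule.Build F lquot
  lquot_scaleA lquot_scale1 lquot_scaleDr lquot_scaleDl.

Lemma lpi_linear : linear lpi_fun.
Proof. by move=> a x y; rewrite lpi_funD lpi_funZ. Qed.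
Definition lpi : {linear V -> lquot} := mklin lpi_linear.

Lemma lpi_eq0 x : lpi x = 0 <-> x \in S.
Proof.
by rewrite -[X in _ = X](linear0 lpi) lpi_eqP subr0.
Qed.
Lemma lpi_surj (y : lquot) : exists x, lpi x = y.
Proof. by exists (repr y); exact: lpi_funK. Qed.

End LinQuotient.

Section Subspace.
Variables (F : fieldType) (V : lmodType F) (S : submodClosed V).

Record lsub := LSub { lsub_val : V; lsubP : lsub_val \in S }.
HB.instance Definition _ := [isSub for lsub_val].
HB.instance Definition _ := [Choice of lsub by <:].
HB.instance Definition _ := [SubChoice_isSubLmodule of lsub by <:].

End Subspace.

Section Homology.
Variables (F : fieldType) (U V W : lmodType F).
Variables (f : {linear U -> V}) (g : {linear V -> W}).

Definition cocycles : {pred V} := fun x => g x == 0.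
Lemma cocycles_submod : submod_closed cocycles.
Proof.
split=> [|a x y]; rewrite !unfold_in ?linear0 // => /eqP gx /eqP gy.
by rewrite linearP gx gy scaler0 addr0.
Qed.
HB.instance Definition _ := GRing.isSubmodClosed.Build F V cocycles
  (GRing.submod_closed_semi cocycles_submod).

Definition coboundaries : {pred lsub cocycles} :=
  fun z => `[< exists y, f y = val z >].
Lemma coboundaries_submod : submod_closed coboundaries.
Proof.
split=> [|a x y]; first by apply/asboolP; exists 0; rewrite !linear0.
move=> /asboolP[u fu] /asboolP[v fv]; apply/asboolP; exists (a *: u + v).
by rewrite !linearP fu fv.
Qed.
HB.instance Definition _ := GRing.isSubmodClosed.Build F (lsub cocycles)
  coboundaries (GRing.submod_closed_semi coboundaries_submod).

(* ker g / (im f /\ ker g), which is ker g / im f when g o f = 0. *)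
Definition homology : lmodType F := lquot coboundaries.

Lemma homology_eq0P :
  (forall c : homology, c = 0) <->
  (forall z, g z = 0 -> exists y, f y = z).
Proof.
split=> [H0 z gz|H0 c].
  have zP : z \in cocycles by rewrite unfold_in gz.
  have /lpi_eq0/asboolP[y fy] := H0 (lpi coboundaries (LSub zP)).
  by exists y.
have [x <-] := lpi_surj c; apply/lpi_eq0/asboolP; apply: H0.
exact/eqP/(lsubP x).
Qed.

End Homology.

Section Span.
Variables (F : fieldType) (V : lmodType F) (A : V -> Prop).

Definition lspan : {pred V} := fun v =>
  `[< forall S : {pred V}, submod_closed S -> (forall u, A u -> u \in S) ->
      v \in S >].

Lemma lspan_submod : submod_closed lspan.
Proof.
split=> [|a u v]; first by apply/asboolP => S [].
move=> /asboolP uA /asboolP vA; apply/asboolP => S clS AS.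
by case: (clS) => _; apply; [exact: uA | exact: vA].
Qed.
HB.instance Definition _ := GRing.isSubmodClosed.Build F V lspan
  (GRing.submod_closed_semi lspan_submod).

Lemma lspan_gen u : A u -> u \in lspan.
Proof. by move=> Au; apply/asboolP => S _; exact. Qed.

End Span.

Section Tensor.
Variables (F : fieldType) (U V : lmodType F).

Local Notation free := {freeg (U * V)%type / F}.

Inductive tens_rel : free -> Prop :=
| TensRelL a u u' v :
    tens_rel (<< (a *: u + u', v) >> - (a *: << (u, v) >> + << (u', v) >>))
| TensRelR a u v v' :
    tens_rel (<< (u, a *: v + v') >> - (a *: << (u, v) >> + << (u, v') >>)).

Definition tens : lmodType F := lquot (lspan tens_rel).

Definition tmk (u : U) (v : V) : tens := lpi (lspan tens_rel) << (u, v) >>.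

Definition bilin (W : lmodType F) (b : U -> V -> W) : Prop :=
  (forall v, linear (b^~ v)) /\ (forall u, linear (b u)).

Lemma tmk_bilin : bilin tmk.
Proof.
split=> [v a u u'|u a v v']; apply/eqP; rewrite -subr_eq0; apply/eqP;
  rewrite /tmk -linearP -linearB; apply/lpi_eq0/lspan_gen; by constructor.
Qed.

Lemma tmkDl u u' v : tmk (u + u') v = tmk u v + tmk u' v.
Proof. by have := (tmk_bilin.1 v) 1 u u'; rewrite !scale1r. Qed.
Lemma tmkDr u v v' : tmk u (v + v') = tmk u v + tmk u v'.
Proof. by have := (tmk_bilin.2 u) 1 v v'; rewrite !scale1r. Qed.
Lemma tmk0l v : tmk 0 v = 0.
Proof. by apply: (addrI (tmk 0 v)); rewrite -tmkDl !addr0. Qed.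
Lemma tmk0r u : tmk u 0 = 0.
Proof. by apply: (addrI (tmk u 0)); rewrite -tmkDr !addr0. Qed.
Lemma tmkZl a u v : tmk (a *: u) v = a *: tmk u v.
Proof. by have := (tmk_bilin.1 v) a u 0; rewrite addr0 tmk0l addr0. Qed.
Lemma tmkZr a u v : tmk u (a *: v) = a *: tmk u v.
Proof. by have := (tmk_bilin.2 u) a v 0; rewrite addr0 tmk0r addr0. Qed.

Lemma free_ext (W : lmodType F) (f g : {linear free -> W}) :
  (forall k, f << k >> = g << k >>) -> f =1 g.
Proof.
move=> fg D; rewrite -[D]freeg_sumE !raddf_sum /=; apply: eq_bigr => k _.
have -> : << (coeff k D) *g k >> = coeff k D *: << k >> :> free.
  by apply/eqP/freeg_eqP => x; rewrite coeffZ !coeffU mul1r.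
by rewrite !linearZ fg.
Qed.

Lemma tens_ext (W : lmodType F) (f g : {linear tens -> W}) :
  (forall u v, f (tmk u v) = g (tmk u v)) -> f = g.
Proof.
move=> fg; apply: linext => t; have [x <-] := lpi_surj t.
apply: (@free_ext W (f \ol lpi _) (g \ol lpi _)) => -[u v]; exact: fg.
Qed.

Section Lift.
Variables (W : lmodType F) (b : U -> V -> W).
Hypothesis b_bilin : bilin b.

Definition free_lift (D : free) : W := fglift (fun k => b k.1 k.2) D.

HB.instance Definition _ := GRing.isZmodMorphism.Build free W free_lift
  (lift_is_additive _).
Lemma free_liftU a k : free_lift << a *g k >> = a *: b k.1 k.2.
Proof. exact: liftU. Qed.

Lemma free_lift_linear : linear free_lift.
Proof.
move=> a x y; rewrite raddfD; congr (_ + _).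
rewrite -[x]freeg_sumE scaler_sumr !raddf_sum /=.
apply: eq_bigr => k _; rewrite free_liftU.
have -> : a *: << (coeff k x) *g k >> = << (a * coeff k x) *g k >> :> free.
  by apply/eqP/freeg_eqP => z; rewrite coeffZ !coeffU mulrA.
by rewrite free_liftU scalerA.
Qed.
Let fl : {linear free -> W} := mklin free_lift_linear.

Lemma free_lift_rel x : x \in lspan tens_rel -> fl x = 0.
Proof.
move=> /asboolP /(_ (cocycles fl) (cocycles_submod fl)) h; apply/eqP/h => u.
have flE k : fl << k >> = b k.1 k.2 by rewrite mklinE free_liftU scale1r.
case=> [a u1 u2 v|a u1 v1 v2]; rewrite unfold_in linearB linearP !flE /=.
  by rewrite b_bilin.1 subrr.
by rewrite b_bilin.2 subrr.
Qed.

Definition tlift_fun (t : tens) : W := free_lift (repr t).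

Lemma tlift_pi x : tlift_fun (lpi (lspan tens_rel) x) = free_lift x.
Proof.
apply/eqP; rewrite -subr_eq0; apply/eqP.
have := @free_lift_rel (repr (lpi (lspan tens_rel) x) - x).
rewrite linearB; apply; apply/lpi_eqP; exact: lpi_funK.
Qed.

Lemma tlift_linear : linear tlift_fun.
Proof.
move=> a x y; have [x' <-] := lpi_surj x; have [y' <-] := lpi_surj y.
by rewrite -linearP !tlift_pi free_lift_linear.
Qed.

Definition tlift : {linear tens -> W} := mklin tlift_linear.

Lemma tliftE u v : tlift (tmk u v) = b u v.
Proof. by rewrite mklinE tlift_pi free_liftU scale1r. Qed.

End Lift.

End Tensor.

Section TensorMaps.
Variables (F : fieldType).

Section Map.
Variables (U V U' V' : lmodType F).

Lemma tmap_bilin (f : {linear U -> U'}) (g : {linear V -> V'}) :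
  bilin (fun u v => tmk (f u) (g v)).
Proof.
split=> [v a x y|u a x y]; rewrite linearP.
  by rewrite tmkDl tmkZl.
by rewrite tmkDr tmkZr.
Qed.

Definition tmap (f : {linear U -> U'}) (g : {linear V -> V'}) :
  {linear tens U V -> tens U' V'} := tlift (tmap_bilin f g).

Lemma tmapE f g u v : tmap f g (tmk u v) = tmk (f u) (g v).
Proof. exact: tliftE. Qed.

Lemma tmapPl a f f' g :
  tmap (a *: f + f') g = a *: tmap f g + tmap f' g.
Proof.
apply: tens_ext => u v.
by rewrite homDE homZE !tmapE homDE homZE tmkDl tmkZl.
Qed.

Lemma tmapPr a f g g' :
  tmap f (a *: g + g') = a *: tmap f g + tmap f g'.
Proof.
apply: tens_ext => u v.
by rewrite homDE homZE !tmapE homDE homZE tmkDr tmkZr.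
Qed.

End Map.

Section Assoc.
Variables (U V W : lmodType F).

Lemma tassoc_bilin2 (w : W) : bilin (fun (u : U) (v : V) => tmk u (tmk v w)).
Proof.
split=> [v a x y|u a x y]; first by rewrite tmkDl tmkZl.
by rewrite tmkDl tmkDr tmkZl tmkZr.
Qed.

Lemma tassoc_bilin : bilin (fun (t : tens U V) (w : W) => tlift (tassoc_bilin2 w) t).
Proof.
split=> [w|t a w w']; first exact: linearP.
rewrite -homZE -homDE; congr (_ t); congr GRing.Linear.sort.
apply: tens_ext => u v; rewrite homDE homZE !tliftE.
by rewrite tmkDr tmkZr tmkDr tmkZr.
Qed.

Definition tassoc : {linear tens (tens U V) W -> tens U (tens V W)} :=
  tlift tassoc_bilin.

Lemma tassocE u v w : tassoc (tmk (tmk u v) w) = tmk u (tmk v w).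
Proof. by rewrite !tliftE. Qed.

End Assoc.

Section Unit.
Variables (U : lmodType F).

Lemma tunitl_bilin : bilin (fun (a : F^o) (u : U) => (a : F) *: u).
Proof.
split=> [u a x y|x a u v] /=; first by rewrite scalerDl scalerA.
by rewrite scalerDr !scalerA mulrC.
Qed.
Lemma tunitr_bilin : bilin (fun (u : U) (a : F^o) => (a : F) *: u).
Proof. by split; [exact: tunitl_bilin.2 | exact: tunitl_bilin.1]. Qed.

Definition tunitl : {linear tens F^o U -> U} := tlift tunitl_bilin.
Definition tunitr : {linear tens U F^o -> U} := tlift tunitr_bilin.

End Unit.

End TensorMaps.

(* [tpow C n] is C^{(x) n}, bracketed to the right, with [tpow C 0 = F],
   [tpow C 1 = C] and [tpow C 2 = tens C C] by conversion. *)

Section TensorPowers.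
Variables (F : fieldType) (C : lmodType F).

Fixpoint tpow (n : nat) : lmodType F :=
  match n with
  | 0 => F^o
  | n'.+1 => match n' with 0 => C | _ => tens C (tpow n') end
  end.

(* The canonical isomorphisms of C (x) C^{(x) n} and C^{(x) n} (x) C with
   C^{(x) n.+1}; in degree 0 they are c (x) a |-> a c and a (x) c |-> a c. *)
Definition tpow_lcons (n : nat) : {linear tens C (tpow n) -> tpow n.+1} :=
  match n return {linear tens C (tpow n) -> tpow n.+1} with
  | 0 => tunitr C
  | _.+1 => idl _
  end.

Fixpoint tpow_rcons (n : nat) : {linear tens (tpow n) C -> tpow n.+1} :=
  match n return {linear tens (tpow n) C -> tpow n.+1} with
  | 0 => tunitl C
  | n1.+1 =>
    match n1 return {linear tens (tpow n1) C -> tpow n1.+1} ->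
                    {linear tens (tpow n1.+1) C -> tpow n1.+2} with
    | 0 => fun _ => idl _
    | n2.+1 => fun rec => tmap (idl C) rec \ol tassoc C (tpow n2.+1) C
    end (tpow_rcons n1)
  end.

(* For i < n, [tpow_at psi n i] is Id^{(x) i} (x) psi (x) Id^{(x) (n-1-i)};
   its value for i >= n is irrelevant. *)
Fixpoint tpow_at (psi : {linear C -> C}) (n i : nat) :
    {linear tpow n -> tpow n} :=
  match n return {linear tpow n -> tpow n} with
  | 0 => 0
  | n1.+1 =>
    match n1 return (nat -> {linear tpow n1 -> tpow n1}) ->
                    {linear tpow n1.+1 -> tpow n1.+1} with
    | 0 => fun _ => psi
    | n2.+1 => fun rec =>
        match i with
        | 0 => tmap psi (idl (tpow n2.+1))
        | i'.+1 => tmap (idl C) (rec i')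
        end
    end (tpow_at psi n1)
  end.

(* For i < n, [tpow_split Delta n i] is
   Id^{(x) i} (x) Delta (x) Id^{(x) (n-1-i)}. *)
Fixpoint tpow_split (Delta : {linear C -> tens C C}) (n i : nat) :
    {linear tpow n -> tpow n.+1} :=
  match n return {linear tpow n -> tpow n.+1} with
  | 0 => 0
  | n1.+1 =>
    match n1 return (nat -> {linear tpow n1 -> tpow n1.+1}) ->
                    {linear tpow n1.+1 -> tpow n1.+2} with
    | 0 => fun _ => Delta
    | n2.+1 => fun rec =>
        match i with
        | 0 => tassoc C C (tpow n2.+1) \ol tmap Delta (idl (tpow n2.+1))
        | i'.+1 => tmap (idl C) (rec i')
        end
    end (tpow_split Delta n1)
  end.

End TensorPowers.

(* [tassoc] identifies the codomain C (x) C (x) C of the two sides. *)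
Record coalgebra (F : fieldType) := Coalgebra {
  coalg_space :> lmodType F;
  comul : {linear coalg_space -> tens coalg_space coalg_space};
  comul_coassoc :
    tmap (idl _) comul \ol comul = tassoc _ _ _ \ol (tmap comul (idl _) \ol comul)
}.

Definition coderivation (F : fieldType) (C : coalgebra F)
    (psi : {linear C -> C}) : Prop :=
  comul C \ol psi = tmap psi (idl C) \ol comul C + tmap (idl C) psi \ol comul C.

Record coder_pair (F : fieldType) := CoderPair {
  coder_coalg :> coalgebra F;
  coder_map : {linear coder_coalg -> coder_coalg};
  coder_mapP : coderivation coder_map
}.

Section Cohomology.
Variables (F : fieldType) (P : coder_pair F).
Local Notation C := (coalg_space (coder_coalg P)).
Local Notation Delta := (comul P).
Local Notation psi := (coder_map P).

Definition cochain (n : nat) : lmodType F := Hom C (tpow C n).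

Definition delta_fun (n : nat) (f : cochain n) : cochain n.+1 :=
  tpow_lcons C n \ol (tmap (idl C) f \ol Delta)
  + \sum_(i < n) (-1) ^+ i.+1 *: (tpow_split Delta n i \ol f)
  + (-1) ^+ n.+1 *: (tpow_rcons C n \ol (tmap f (idl C) \ol Delta)).

Definition omega_fun (n : nat) (f : cochain n) : cochain n :=
  \sum_(i < n) (tpow_at psi n i \ol f) - f \ol psi.

Lemma delta_linear n : linear (@delta_fun n).
Proof.
move=> a f g; rewrite /delta_fun.
have -> := tmapPr a (idl C) f g; have -> := tmapPl a f g (idl C).
rewrite !complPl !complPr !scalerDr; under eq_bigr => i _.
  have -> := complPr a (tpow_split Delta n i) f g.
  rewrite scalerDr scalerA [_ * a]mulrC -scalerA.
  over.
rewrite big_split /= -scaler_sumr [in X in _ + X]scalerA [_ * a]mulrC -scalerA.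
by rewrite [RHS]addrACA; congr (_ + _); rewrite [RHS]addrACA.
Qed.
Definition delta n : {linear cochain n -> cochain n.+1} := mklin (@delta_linear n).

Lemma omega_linear n : linear (@omega_fun n).
Proof.
move=> a f g; rewrite /omega_fun.
have -> := complPl a f g psi; under eq_bigr => i _.
  have -> := complPr a (tpow_at psi n i) f g.
  over.
by rewrite big_split /= -scaler_sumr scalerBr opprD addrACA.
Qed.
Definition omega n : {linear cochain n -> cochain n} := mklin (@omega_linear n).

(* In degree n >= 2 the pair (f, g) has f in cochain n and g in cochain n.-1;
   ['rV[F]_0] is the zero space. *)
Definition coder_cochain (n : nat) : lmodType F :=
  match n with
  | 0 => 'rV[F]_0
  | 1 => cochain 1
  | n'.+2 => (cochain n'.+2 * cochain n'.+1)%type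
  end.

Definition d1_fun (f : cochain 1) : cochain 2 * cochain 1 :=
  (delta 1 f, - omega 1 f).
Lemma d1_linear : linear d1_fun.
Proof.
move=> a f g; congr pair; first exact: (linearP (delta 1)).
by have -> := linearP (omega 1) a f g; rewrite opprD -scalerN.
Qed.

Definition dn_fun n (x : cochain n.+1 * cochain n) :
    cochain n.+2 * cochain n.+1 :=
  (delta n.+1 x.1, delta n x.2 + (-1) ^+ n.+1 *: omega n.+1 x.1).
Lemma dn_linear n : linear (@dn_fun n).
Proof.
move=> a [f1 f2] [g1 g2]; congr pair; first exact: (linearP (delta n.+1)).
have -> := linearP (delta n) a f2 g2; have -> := linearP (omega n.+1) a f1 g1.
by rewrite [in RHS]/dn_fun /= !scalerDr addrACA !scalerA [a * _]mulrC.
Qed.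

Definition coder_d (n : nat) : {linear coder_cochain n -> coder_cochain n.+1} :=
  match n return {linear coder_cochain n -> coder_cochain n.+1} with
  | 0 => 0
  | 1 => mklin d1_linear
  | n'.+2 => mklin (@dn_linear n'.+1)
  end.

Definition H_Coder (n : nat) : lmodType F :=
  match n with
  | 0 => homology (0 : {linear 'rV[F]_0 -> coder_cochain 0}) (coder_d 0)
  | n'.+1 => homology (coder_d n') (coder_d n'.+1)
  end.

End Cohomology.

Section PowerSeries.
Variable F : fieldType.

Definition pser (U V : lmodType F) := nat -> {linear U -> V}.

Definition pconst (U V : lmodType F) (f : {linear U -> V}) : pser U V :=
  fun n => if n is 0 then f else 0.

Definition padd (U V : lmodType F) (f g : pser U V) : pser U V :=
  fun n => f n + g n.

Definition pcomp (U V W : lmodType F) (g : pser V W) (f : pser U V) : pser U W :=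
  fun n => \sum_(i < n.+1) (g i \ol f (n - i)%N).

Definition ptens (U V U' V' : lmodType F) (f : pser U U') (g : pser V V') :
    pser (tens U V) (tens U' V') :=
  fun n => \sum_(i < n.+1) tmap (f i) (g (n - i)%N).

Lemma pcomp_const (U V W : lmodType F) (g : {linear V -> W}) (f : {linear U -> V}) :
  pcomp (pconst g) (pconst f) =1 pconst (g \ol f).
Proof.
move=> [|n]; first by rewrite /pcomp big_ord1.
apply: linext => x; rewrite hom_sumE big1 // => -[[|i] _] _ //=.
by rewrite linear0.
Qed.

Lemma ptens_const (U V U' V' : lmodType F) (f : {linear U -> U'})
    (g : {linear V -> V'}) :
  ptens (pconst f) (pconst g) =1 pconst (tmap f g).
Proof.
move=> [|n]; first by rewrite /ptens big_ord1.
apply: tens_ext => u v; rewrite hom_sumE big1 // => -[[|i] lti] _.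
  by rewrite tmapE; exact: tmk0r.
by rewrite tmapE; exact: tmk0l.
Qed.

End PowerSeries.

Section Deformations.
Variables (F : fieldType) (P : coder_pair F).
Local Notation C := (coalg_space (coder_coalg P)).
Local Notation Id_t := (pconst (idl C)).

Record deformation := Deformation {
  def_comul : pser C (tens C C);
  def_coder : pser C C;
  def_comul0 : def_comul 0%N = comul P;
  def_coder0 : def_coder 0%N = coder_map P;
  def_coassoc :
    pcomp (ptens Id_t def_comul) def_comul =1
    pcomp (pconst (tassoc C C C)) (pcomp (ptens def_comul Id_t) def_comul);
  def_coderP :
    pcomp def_comul def_coder =1
    padd (pcomp (ptens def_coder Id_t) def_comul)
         (pcomp (ptens Id_t def_coder) def_comul)
}.

Definition equivalent (D E : deformation) : Prop :=
  exists Phi : pser C C,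
    [/\ Phi 0%N = idl C,
        pcomp (def_comul E) Phi =1 pcomp (ptens Phi Phi) (def_comul D)
      & pcomp (def_coder E) Phi =1 pcomp Phi (def_coder D)].

Lemma undeformed_coassoc :
  pcomp (ptens Id_t (pconst (comul P))) (pconst (comul P)) =1
  pcomp (pconst (tassoc C C C))
        (pcomp (ptens (pconst (comul P)) Id_t) (pconst (comul P))).
Proof.
do 2!rewrite (funext (ptens_const _ _)); rewrite !(funext (pcomp_const _ _)) => n.
by rewrite comul_coassoc.
Qed.

Lemma undeformed_coderP :
  pcomp (pconst (comul P)) (pconst (coder_map P)) =1
  padd (pcomp (ptens (pconst (coder_map P)) Id_t) (pconst (comul P)))
       (pcomp (ptens Id_t (pconst (coder_map P))) (pconst (comul P))).
Proof.
do 2!rewrite (funext (ptens_const _ _)); rewrite !(funext (pcomp_const _ _)).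
move=> [|n]; last by rewrite /padd /= addr0.
exact: coder_mapP.
Qed.

Definition undeformed : deformation :=
  @Deformation (pconst (comul P)) (pconst (coder_map P)) erefl erefl
    undeformed_coassoc undeformed_coderP.

Definition trivial_deformation (D : deformation) : Prop :=
  equivalent D undeformed.

Definition rigid : Prop := forall D : deformation, trivial_deformation D.

End Deformations.

(* Main.v *)
(* Build the equivalence Phi_t coefficient by coefficient.  For any series Phi
   with Phi_0 = Id put E = (Phi (x) Phi) Delta_t - Delta Phi and
   G = Phi psi_t - psi Phi.  If E and G vanish in degrees < n, then comparing
   the n-th coefficients in the coassociativity of Delta_t composed with
   Phi (x) Phi (x) Phi, and in the coderivation identity of psi_t composed with
   Phi (x) Phi, shows that (E_n, G_n) is a 2-cocycle.  Replacing Phi_n by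
   Phi_n - f changes (E_n, G_n) by -d(f) and nothing below degree n, so the
   vanishing of H^2 makes E and G vanish in degree n as well.  Neither the
   inverse of Phi_t nor an infinite product of automorphisms is needed. *)

Require Import Defs.
From mathcomp Require Import all_boot all_algebra.
From mathcomp Require Import boolp.

Set Implicit Arguments.
Unset Strict Implicit.
Unset Printing Implicit Defensive.

Import GRing.Theory.
Local Open Scope ring_scope.

(* These names are shadowed by [vector] and [ssrfun]. *)
Local Notation Hom := Defs.Hom.
Local Notation pcomp := Defs.pcomp.

(** * Cauchy products for an arbitrary bilinear operation *)

Section Cauchy.
Variable F : fieldType.
Implicit Types A B C E AB AC BC : lmodType F.

(** Both [pcomp] and [ptens] are instances up to conversion, with [compl] and [tmap] as operation,
    so their common laws are proved once. *)
Definition cauchy A B C (op : A -> B -> C) (f : nat -> A) (g : nat -> B) :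
    nat -> C :=
  fun n => \sum_(i < n.+1) op (f i) (g (n - i)%N).

Lemma bilin_suml A B C (op : A -> B -> C) (I : Type) (r : seq I) (P : pred I)
    (f : I -> A) (b : B) : bilin op ->
  op (\sum_(i <- r | P i) f i) b = \sum_(i <- r | P i) op (f i) b.
Proof. by case=> opl _; exact: (linear_sum (mklin (opl b))). Qed.

Lemma bilin_sumr A B C (op : A -> B -> C) (I : Type) (r : seq I) (P : pred I)
    (a : A) (f : I -> B) : bilin op ->
  op a (\sum_(i <- r | P i) f i) = \sum_(i <- r | P i) op a (f i).
Proof. by case=> _ opr; exact: (linear_sum (mklin (opr a))). Qed.

Lemma bilin0l A B C (op : A -> B -> C) b : bilin op -> op 0 b = 0.
Proof. by case=> opl _; exact: (linear0 (mklin (opl b))). Qed.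

Lemma bilin0r A B C (op : A -> B -> C) a : bilin op -> op a 0 = 0.
Proof. by case=> _ opr; exact: (linear0 (mklin (opr a))). Qed.

Lemma bilinDl A B C (op : A -> B -> C) a a' b : bilin op ->
  op (a + a') b = op a b + op a' b.
Proof. by case=> opl _; exact: (linearD (mklin (opl b))). Qed.

Lemma bilinDr A B C (op : A -> B -> C) a b b' : bilin op ->
  op a (b + b') = op a b + op a b'.
Proof. by case=> _ opr; exact: (linearD (mklin (opr a))). Qed.

(** Makes the range of [j] independent of [i], so that the two sums can be exchanged. *)
Lemma sum_triangle A n (G : nat -> nat -> A) :
  \sum_(i < n.+1) \sum_(j < (n - i).+1) G i j =
  \sum_(i < n.+1) \sum_(j < n.+1 | (i + j <= n)%N) G i j.
Proof.
apply: eq_bigr => i _; have le_in : (i <= n)%N by rewrite -ltnS.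
rewrite (big_ord_widen n.+1 (G i)) ?ltnS ?leq_subr //.
by apply: eq_bigl => j; rewrite ltnS leq_subRL.
Qed.

Lemma sum_triangleC A n (G : nat -> nat -> A) :
  \sum_(i < n.+1) \sum_(j < (n - i).+1) G i j =
  \sum_(j < n.+1) \sum_(i < (n - j).+1) G i j.
Proof.
rewrite !sum_triangle (exchange_big_dep xpredT) //=.
rewrite (sum_triangle n (fun j i => G i j)).
by apply: eq_bigr => j _; apply: eq_bigl => i; rewrite addnC.
Qed.

(** Induction on [n]: the step adds the antidiagonal i + j = n + 1, that is, one last term to each
    inner sum on the right and the new row i = n + 1. *)
Lemma sum_diagonal A n (G : nat -> nat -> A) :
  \sum_(k < n.+1) \sum_(i < k.+1) G i (k - i)%N =
  \sum_(i < n.+1) \sum_(j < (n - i).+1) G i j.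
Proof.
elim: n => [|n IHn]; first by rewrite !big_ord1.
rewrite big_ord_recr {}IHn /= [RHS]big_ord_recr /= subnn big_ord1.
rewrite [X in _ + X = _]big_ord_recr /= subnn addrA -big_split /=.
congr (_ + _); apply: eq_bigr => i _.
have le_in : (i <= n)%N by rewrite -ltnS.
by rewrite subSn // [RHS]big_ord_recr.
Qed.

(** Both coefficients are sums over i + j + k = n. Four operations occur because composition and
    tensor product of maps change the ambient Hom space. *)
Lemma cauchyA A B C AB BC E (op1 : AB -> C -> E) (op2 : A -> B -> AB)
    (op3 : A -> BC -> E) (op4 : B -> C -> BC) f g h :
  bilin op1 -> bilin op3 ->
  (forall a b c, op1 (op2 a b) c = op3 a (op4 b c)) ->
  cauchy op1 (cauchy op2 f g) h = cauchy op3 f (cauchy op4 g h).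
Proof.
move=> bil1 bil3 opA; apply: funext => n; rewrite /cauchy.
transitivity (\sum_(k < n.+1) \sum_(i < k.+1)
    op3 (f i) (op4 (g (k - i)%N) (h (n - i - (k - i))%N))).
  apply: eq_bigr => k _; rewrite bilin_suml //; apply: eq_bigr => i _.
  have le_ik : (i <= k)%N by rewrite -ltnS.
  by rewrite opA -subnDA subnKC.
rewrite (sum_diagonal n (fun i j => op3 (f i) (op4 (g j) (h (n - i - j)%N)))).
by apply: eq_bigr => i _; rewrite bilin_sumr.
Qed.

Lemma cauchyCA A B C AC BC E (op1 : A -> BC -> E) (op2 : B -> C -> BC)
    (op3 : B -> AC -> E) (op4 : A -> C -> AC) f g h :
  bilin op1 -> bilin op3 ->
  (forall a b c, op1 a (op2 b c) = op3 b (op4 a c)) ->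
  cauchy op1 f (cauchy op2 g h) = cauchy op3 g (cauchy op4 f h).
Proof.
move=> bil1 bil3 opCA; apply: funext => n; rewrite /cauchy.
transitivity (\sum_(i < n.+1) \sum_(j < (n - i).+1)
    op3 (g j) (op4 (f i) (h (n - j - i)%N))).
  apply: eq_bigr => i _; rewrite bilin_sumr //; apply: eq_bigr => j _.
  by rewrite opCA subnAC.
rewrite (sum_triangleC n (fun i j => op3 (g j) (op4 (f i) (h (n - j - i)%N)))).
by apply: eq_bigr => i _; rewrite bilin_sumr.
Qed.

Lemma cauchyDl A B C (op : A -> B -> C) f f' g : bilin op ->
  cauchy op (fun n => f n + f' n) g =
  fun n => cauchy op f g n + cauchy op f' g n.
Proof.
move=> bil; apply: funext => n; rewrite -big_split.
by apply: eq_bigr => i _; rewrite bilinDl.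
Qed.

Lemma cauchyDr A B C (op : A -> B -> C) f g g' : bilin op ->
  cauchy op f (fun n => g n + g' n) =
  fun n => cauchy op f g n + cauchy op f g' n.
Proof.
move=> bil; apply: funext => n; rewrite -big_split.
by apply: eq_bigr => i _; rewrite bilinDr.
Qed.

Lemma cauchy_lowl A B C (op : A -> B -> C) f g n : bilin op ->
  (forall i, (i < n)%N -> f i = 0) -> cauchy op f g n = op (f n) (g 0%N).
Proof.
move=> bil f0; rewrite /cauchy big_ord_recr /= subnn big1 ?add0r // => i _.
by rewrite f0 // bilin0l.
Qed.

Lemma cauchy_lowr A B C (op : A -> B -> C) f g n : bilin op ->
  (forall i, (i < n)%N -> g i = 0) -> cauchy op f g n = op (f 0%N) (g n).
Proof.
move=> bil g0; rewrite /cauchy big_ord_recl /= subn0 big1 ?addr0 // => i _.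
(* The remaining indices are i + 1 with i < n, so n - (i + 1) is below n. *)
rewrite g0 ?bilin0r // /bump add1n ltn_subrL /=.
exact: leq_ltn_trans (leq0n i) (ltn_ord i).
Qed.

End Cauchy.

(** * Composition and tensor product of power series of linear maps *)

Section Pser.
Variable F : fieldType.
Implicit Types U V W : lmodType F.

Lemma compl_bilin U V W :
  @bilin F (Hom V W) (Hom U V) (Hom U W) (@compl F U V W).
Proof.
by split=> [f a g g'|g a f f']; [exact: complPl | exact: complPr].
Qed.

Lemma tmap_bilin_hom U V U' V' :
  @bilin F (Hom U U') (Hom V V') (Hom (tens U V) (tens U' V'))
    (@tmap F U V U' V').
Proof.
by split=> [g a f f'|f a g g']; [exact: tmapPl | exact: tmapPr].
Qed.

Lemma complE U V W (g : {linear V -> W}) (f : {linear U -> V}) x :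
  (g \ol f) x = g (f x).
Proof. by []. Qed.

Lemma tmap_comp U V W U' V' W' (f : {linear V -> W}) (g : {linear U -> V})
    (f' : {linear V' -> W'}) (g' : {linear U' -> V'}) :
  tmap (f \ol g) (f' \ol g') = tmap f f' \ol tmap g g'.
Proof. by apply: tens_ext => u v; rewrite complE !tmapE. Qed.

Lemma tmap_id U V : tmap (idl U) (idl V) = idl (tens U V).
Proof. by apply: tens_ext => u v; rewrite tmapE. Qed.

Lemma tens_ext3 U V W W' (f g : {linear tens (tens U V) W -> W'}) :
  (forall u v w, f (tmk (tmk u v) w) = g (tmk (tmk u v) w)) -> f = g.
Proof.
(* For fixed [w], the map t |-> t (x) w is linear, which reduces the claim to extensionality on
   [tens U V]. *)
move=> fg; apply: tens_ext => t w; pose k := mklin ((@tmk_bilin F (tens U V) W).1 w).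
change ((f \ol k) t = (g \ol k) t).
suff -> : f \ol k = g \ol k by [].
by apply: tens_ext => u v; exact: fg.
Qed.

Lemma tassoc_nat U V W U' V' W' (f : {linear U -> U'}) (g : {linear V -> V'})
    (h : {linear W -> W'}) :
  tassoc _ _ _ \ol tmap (tmap f g) h = tmap f (tmap g h) \ol tassoc _ _ _.
Proof. by apply: tens_ext3 => u v w; rewrite !(complE, tmapE, tassocE). Qed.

Lemma pcompA U V W U' (h : pser W U') (g : pser V W) (f : pser U V) :
  pcomp (pcomp h g) f = pcomp h (pcomp g f).
Proof.
by apply: cauchyA => [||a b c]; [exact: compl_bilin.. | exact: linext].
Qed.

(** Interchange law. Factoring a (x) b as (a (x) Id) (Id (x) b) turns it into two uses of [cauchyA]
    and one of [cauchyCA], which moves [f'] past [g]. *)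
Lemma ptens_pcomp U V W U' V' W' (f : pser V W) (g : pser U V)
    (f' : pser V' W') (g' : pser U' V') :
  ptens (pcomp f g) (pcomp f' g') = pcomp (ptens f f') (ptens g g').
Proof.
pose opl (a : Hom V W) (x : Hom (tens U U') (tens V W')) :
  Hom (tens U U') (tens W W') := tmap a (idl W') \ol x.
pose opr (a : Hom V' W') (x : Hom (tens U U') (tens V V')) :
  Hom (tens U U') (tens V W') := tmap (idl V) a \ol x.
have bill : bilin opl.
  split=> [x c a a'|a c x x']; rewrite /opl.
    by have -> := tmapPl c a a' (idl W'); exact: complPl.
  exact: complPr.
have bilr : bilin opr.
  split=> [x c a a'|a c x x']; rewrite /opr.
    by have -> := tmapPr c (idl V) a a'; exact: complPl.
  exact: complPr.
transitivity (cauchy opl f (cauchy opr f' (cauchy (@tmap F U U' V V') g g'))).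
  transitivity (cauchy opl f (cauchy (@tmap F _ _ _ _) g (pcomp f' g'))).
    apply: cauchyA => [||a b c]; [exact: tmap_bilin_hom | exact: bill |].
    by rewrite /opl -tmap_comp; congr tmap; exact: linext.
  congr cauchy; apply: cauchyCA => [||a b c] //; first exact: tmap_bilin_hom.
  by rewrite /opr -tmap_comp; congr tmap; exact: linext.
apply/esym/cauchyA => [||a b c]; [exact: compl_bilin | exact: bill |].
transitivity ((tmap a (idl W') \ol tmap (idl V) b) \ol c).
  by rewrite -tmap_comp; congr (tmap _ _ \ol c); exact: linext.
exact: linext.
Qed.

Lemma pcomp_constl U V W (a : {linear V -> W}) (f : pser U V) :
  pcomp (pconst a) f = fun n => a \ol f n.
Proof.
apply: funext => n; rewrite /pcomp big_ord_recl /= subn0 big1 ?addr0 // => i _.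
exact: (bilin0l _ (@compl_bilin U V W)).
Qed.

Lemma pcomp_constr U V W (a : {linear U -> V}) (f : pser V W) :
  pcomp f (pconst a) = fun n => f n \ol a.
Proof.
apply: funext => n; rewrite /pcomp big_ord_recr /= subnn big1 ?add0r // => i _.
(* Here n - i is positive, and a constant series vanishes in positive degrees. *)
have := ltn_ord i; rewrite -subn_gt0; case: (n - i)%N => // m _.
exact: (bilin0r _ (@compl_bilin U V W)).
Qed.

Lemma pcomp_idl U V (f : pser U V) : pcomp (pconst (idl V)) f = f.
Proof. by rewrite pcomp_constl; apply: funext => n; exact: linext. Qed.

Lemma pcomp_idr U V (f : pser U V) : pcomp f (pconst (idl U)) = f.
Proof. by rewrite pcomp_constr; apply: funext => n; exact: linext. Qed.

(** Absorbing the associator into the outer operations makes its naturality the associativity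
    hypothesis of [cauchyA]. *)
Lemma ptens_tassoc U V W U' V' W' (f : pser U U') (g : pser V V')
    (h : pser W W') :
  pcomp (pconst (tassoc _ _ _)) (ptens (ptens f g) h) =
  pcomp (ptens f (ptens g h)) (pconst (tassoc _ _ _)).
Proof.
pose op1 (x : Hom (tens U V) (tens U' V')) (c : Hom W W') :
  Hom (tens (tens U V) W) (tens U' (tens V' W')) := tassoc _ _ _ \ol tmap x c.
pose op3 (a : Hom U U') (y : Hom (tens V W) (tens V' W')) :
  Hom (tens (tens U V) W) (tens U' (tens V' W')) := tmap a y \ol tassoc _ _ _.
have bil1 : bilin op1.
  split=> [c k x x'|x k c c']; rewrite /op1.
    by have -> := tmapPl k x x' c; exact: complPr.
  by have -> := tmapPr k x c c'; exact: complPr.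
have bil3 : bilin op3.
  split=> [y k a a'|a k y y']; rewrite /op3.
    by have -> := tmapPl k a a' y; exact: complPl.
  by have -> := tmapPr k a y y'; exact: complPl.
rewrite pcomp_constl pcomp_constr.
transitivity (cauchy op1 (ptens f g) h).
  by apply: funext => n; exact: (bilin_sumr _ _ _ _ (@compl_bilin _ _ _)).
transitivity (cauchy op3 f (ptens g h)).
  apply: cauchyA => // a b c; exact: tassoc_nat.
apply: funext => n.
exact/esym/(bilin_suml _ _ _ _ (@compl_bilin _ _ _)).
Qed.

End Pser.

(** * Additivity and lowest-degree coefficients *)

Section PserLinear.
Variable F : fieldType.
Implicit Types U V W : lmodType F.

Lemma pcompDl U V W (g g' : pser V W) (f : pser U V) :
  pcomp (padd g g') f = padd (pcomp g f) (pcomp g' f).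
Proof. exact: (cauchyDl _ _ _ (@compl_bilin F U V W)). Qed.

Lemma pcompDr U V W (g : pser V W) (f f' : pser U V) :
  pcomp g (padd f f') = padd (pcomp g f) (pcomp g f').
Proof. exact: (cauchyDr _ _ _ (@compl_bilin F U V W)). Qed.

Lemma ptensDl U V U' V' (f f' : pser U U') (g : pser V V') :
  ptens (padd f f') g = padd (ptens f g) (ptens f' g).
Proof. exact: (cauchyDl _ _ _ (@tmap_bilin_hom F U V U' V')). Qed.

Lemma ptensDr U V U' V' (f : pser U U') (g g' : pser V V') :
  ptens f (padd g g') = padd (ptens f g) (ptens f g').
Proof. exact: (cauchyDr _ _ _ (@tmap_bilin_hom F U V U' V')). Qed.

Lemma pcomp_lowl U V W (g : pser V W) (f : pser U V) n :
  (forall i, (i < n)%N -> g i = 0) -> pcomp g f n = g n \ol f 0%N.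
Proof. by move=> g0; exact: (cauchy_lowl _ (@compl_bilin F U V W) g0). Qed.

Lemma ptens_lowl U V U' V' (f : pser U U') (g : pser V V') n :
  (forall i, (i < n)%N -> f i = 0) -> ptens f g n = tmap (f n) (g 0%N).
Proof. by move=> f0; exact: (cauchy_lowl _ (@tmap_bilin_hom F U V U' V') f0). Qed.

Lemma ptens_lowr U V U' V' (f : pser U U') (g : pser V V') n :
  (forall i, (i < n)%N -> g i = 0) -> ptens f g n = tmap (f 0%N) (g n).
Proof. by move=> g0; exact: (cauchy_lowr _ (@tmap_bilin_hom F U V U' V') g0). Qed.

Lemma complDr U V W (g : {linear V -> W}) (f f' : {linear U -> V}) :
  g \ol (f + f') = g \ol f + g \ol f'.
Proof. exact: (bilinDr _ _ _ (@compl_bilin F U V W)). Qed.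

Lemma complDl U V W (g g' : {linear V -> W}) (f : {linear U -> V}) :
  (g + g') \ol f = g \ol f + g' \ol f.
Proof. exact: linext. Qed.

Lemma complA U V W U' (h : {linear W -> U'}) (g : {linear V -> W})
    (f : {linear U -> V}) : (h \ol g) \ol f = h \ol (g \ol f).
Proof. exact: linext. Qed.

Lemma ptens_pcomp_lowl U V U' V' W (f : pser U U') (g : pser V V')
    (h : pser W (tens U V)) n :
  (forall i, (i < n)%N -> f i = 0) ->
  pcomp (ptens f g) h n = tmap (f n) (g 0%N) \ol h 0%N.
Proof.
move=> f0; rewrite pcomp_lowl ?ptens_lowl // => i lt_in.
rewrite ptens_lowl => [|j lt_ji]; last exact: f0 (ltn_trans lt_ji lt_in).
rewrite f0 //; exact: (bilin0l _ (@tmap_bilin_hom F U V U' V')).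
Qed.

Lemma ptens_pcomp_lowr U V U' V' W (f : pser U U') (g : pser V V')
    (h : pser W (tens U V)) n :
  (forall i, (i < n)%N -> g i = 0) ->
  pcomp (ptens f g) h n = tmap (f 0%N) (g n) \ol h 0%N.
Proof.
move=> g0; rewrite pcomp_lowl ?ptens_lowr // => i lt_in.
rewrite ptens_lowr => [|j lt_ji]; last exact: g0 (ltn_trans lt_ji lt_in).
rewrite g0 //; exact: (bilin0r _ (@tmap_bilin_hom F U V U' V')).
Qed.

End PserLinear.

(** The cancellation in [obs_coder_lowest]: [a] and [b] are the two halves of Delta psi Phi_n given
    by the coderivation property of psi. *)
Lemma addr_cancel4 (V : zmodType) (a b p q r s x y : V) :
  a + b + x + y = (a + p + q) + (b + r + s) -> x + y = (p + r) + (q + s).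
Proof.
rewrite -(addrA (a + b)) -(addrA a p) -(addrA b r).
rewrite (addrACA a (p + q)) => /addrI ->.
exact: addrACA.
Qed.

(** * The obstruction series of a candidate equivalence *)

Section Obstruction.
Variables (F : fieldType) (P : coder_pair F) (D : deformation P).
Local Notation C := (coalg_space (coder_coalg P)).
Local Notation Delta := (comul P).
Local Notation psi := (coder_map P).
Local Notation Id_t := (pconst (idl C)).
Local Notation Delta_t := (def_comul D).
Local Notation psi_t := (def_coder D).
Implicit Types Phi K : pser C C.

(** The series E of the overview; [obs_coder] is G. Both vanish, for Phi_0 = Id, exactly when [Phi]
    is an equivalence from [D] to the undeformed pair. *)
Definition obs_comul Phi : pser C (tens C C) :=
  fun n => pcomp (ptens Phi Phi) Delta_t n - Delta \ol Phi n.

Definition obs_coder Phi : pser C C :=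
  fun n => pcomp Phi psi_t n - psi \ol Phi n.

Lemma obs_comulE Phi :
  pcomp (ptens Phi Phi) Delta_t =
  padd (pcomp (pconst Delta) Phi) (obs_comul Phi).
Proof.
by rewrite pcomp_constl; apply: funext => n; rewrite /padd /obs_comul addrC subrK.
Qed.

Lemma obs_coderE Phi :
  pcomp Phi psi_t = padd (pcomp (pconst psi) Phi) (obs_coder Phi).
Proof.
by rewrite pcomp_constl; apply: funext => n; rewrite /padd /obs_coder addrC subrK.
Qed.

(** By the interchange law the left side is (Phi (x) (Delta Phi + E)) Delta_t, and Delta Phi + E is
    (Phi (x) Phi) Delta_t. *)
Lemma obs_coassocl Phi :
  padd (pcomp (ptens Id_t (pconst Delta)) (pcomp (ptens Phi Phi) Delta_t))
       (pcomp (ptens Phi (obs_comul Phi)) Delta_t) =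
  pcomp (ptens Phi (ptens Phi Phi)) (pcomp (ptens Id_t Delta_t) Delta_t).
Proof.
rewrite -pcompA -ptens_pcomp pcomp_idl -pcompDl -ptensDr -obs_comulE.
by rewrite -[RHS]pcompA -ptens_pcomp pcomp_idr.
Qed.

Lemma obs_coassocr Phi :
  padd (pcomp (ptens (pconst Delta) Id_t) (pcomp (ptens Phi Phi) Delta_t))
       (pcomp (ptens (obs_comul Phi) Phi) Delta_t) =
  pcomp (ptens (ptens Phi Phi) Phi) (pcomp (ptens Delta_t Id_t) Delta_t).
Proof.
rewrite -pcompA -ptens_pcomp pcomp_idl -pcompDl -ptensDl -obs_comulE.
by rewrite -[RHS]pcompA -ptens_pcomp pcomp_idr.
Qed.

(** Coassociativity of Delta_t followed by Phi (x) Phi (x) Phi, with the associator carried across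
    by [ptens_tassoc]. *)
Lemma obs_coassoc Phi :
  padd (pcomp (ptens Id_t (pconst Delta)) (pcomp (ptens Phi Phi) Delta_t))
       (pcomp (ptens Phi (obs_comul Phi)) Delta_t) =
  pcomp (pconst (tassoc C C C))
    (padd (pcomp (ptens (pconst Delta) Id_t) (pcomp (ptens Phi Phi) Delta_t))
          (pcomp (ptens (obs_comul Phi) Phi) Delta_t)).
Proof.
rewrite obs_coassocl obs_coassocr (funext (@def_coassoc _ _ D)).
by rewrite -pcompA -ptens_tassoc pcompA.
Qed.

(** Two expansions of (Phi (x) Phi) Delta_t psi_t: the left one extracts E, the right one uses the
    coderivation identity of psi_t and extracts G. *)
Lemma obs_coderivation Phi :
  padd (pcomp (pconst Delta) (pcomp Phi psi_t)) (pcomp (obs_comul Phi) psi_t) =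
  padd (padd (pcomp (ptens (pconst psi) Id_t) (pcomp (ptens Phi Phi) Delta_t))
             (pcomp (ptens (obs_coder Phi) Phi) Delta_t))
       (padd (pcomp (ptens Id_t (pconst psi)) (pcomp (ptens Phi Phi) Delta_t))
             (pcomp (ptens Phi (obs_coder Phi)) Delta_t)).
Proof.
rewrite -pcompA -pcompDl -obs_comulE pcompA (funext (@def_coderP _ _ D)).
rewrite pcompDr -!pcompA -!ptens_pcomp !pcomp_idr !pcomp_idl -!pcompDl.
by rewrite -ptensDl -ptensDr -!obs_coderE.
Qed.

(** * The differentials in degrees 1 and 2 *)

Lemma delta1E (f : {linear C -> C}) :
  delta P 1 f =
  tmap (idl C) f \ol Delta - Delta \ol f + tmap f (idl C) \ol Delta.
Proof.
rewrite mklinE /delta_fun big_ord1 /= expr1 scaleN1r sqrrN expr1n scale1r.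
by congr (_ - _ + _); exact: linext.
Qed.

(** Terms are grouped by sign, so that [obs_comul_lowest] says that the difference is zero. *)
Lemma delta2E (f : {linear C -> tens C C}) :
  delta P 2 f =
  (tmap (idl C) f \ol Delta + tmap (idl C) Delta \ol f) -
  (tassoc C C C \ol (tmap Delta (idl C) \ol f) +
   tassoc C C C \ol (tmap f (idl C) \ol Delta)).
Proof.
rewrite mklinE /delta_fun !big_ord_recl big_ord0 addr0 /=.
rewrite expr1 !scaleN1r (exprSr _ 2) sqrrN expr1n mul1r scale1r scaleN1r.
rewrite opprD [RHS]addrA (addrC (- _) (_ \ol f)) addrA tmap_id.
by congr (_ + _ - _ - _); exact: linext.
Qed.

Lemma omega1E (f : {linear C -> C}) : omega P 1 f = psi \ol f - f \ol psi.
Proof. by rewrite mklinE /omega_fun big_ord1. Qed.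

Lemma omega2E (f : {linear C -> tens C C}) :
  omega P 2 f =
  tmap psi (idl C) \ol f + tmap (idl C) psi \ol f - f \ol psi.
Proof. by rewrite mklinE /omega_fun !big_ord_recl big_ord0 addr0. Qed.

(** * The lowest obstruction is a 2-cocycle *)

Section LowestDegree.
Variables (Phi : pser C C) (n : nat).
Hypothesis Phi0 : Phi 0%N = idl C.
Hypothesis obs_comul0 : forall i, (i < n)%N -> obs_comul Phi i = 0.
Hypothesis obs_coder0 : forall i, (i < n)%N -> obs_coder Phi i = 0.
Local Notation E := (obs_comul Phi n).
Local Notation G := (obs_coder Phi n).

Lemma pcomp_pconst_tmap (U V : lmodType F) (f : {linear C -> U}) (g : {linear C -> V}) :
  pcomp (ptens (pconst f) (pconst g)) (pcomp (ptens Phi Phi) Delta_t) n =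
  tmap f g \ol (Delta \ol Phi n) + tmap f g \ol E.
Proof.
rewrite (funext (ptens_const f g)) obs_comulE pcompDr !pcomp_constl.
by rewrite /padd.
Qed.

Lemma obs_comul_lowest :
  tmap (idl C) Delta \ol E + tmap (idl C) E \ol Delta =
  tassoc C C C \ol (tmap Delta (idl C) \ol E) +
  tassoc C C C \ol (tmap E (idl C) \ol Delta).
Proof.
have := congr1 (fun f => f n) (obs_coassoc Phi); rewrite pcomp_constl /padd.
rewrite !pcomp_pconst_tmap ptens_pcomp_lowr // ptens_pcomp_lowl //.
rewrite Phi0 def_comul0 !complDr -!addrA.
(* The terms in [Phi n] agree by coassociativity of [Delta] and cancel, leaving only [E]. *)
have -> : tmap (idl C) Delta \ol (Delta \ol Phi n) =
    tassoc C C C \ol (tmap Delta (idl C) \ol (Delta \ol Phi n)).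
  by rewrite -complA comul_coassoc !complA.
exact: addrI.
Qed.

Lemma obs_coder_lowest :
  Delta \ol G + E \ol psi =
  (tmap psi (idl C) \ol E + tmap (idl C) psi \ol E) +
  (tmap G (idl C) \ol Delta + tmap (idl C) G \ol Delta).
Proof.
have := congr1 (fun f => f n) (obs_coderivation Phi).
rewrite obs_coderE pcompDr !pcomp_constl /padd.
rewrite !pcomp_pconst_tmap (ptens_pcomp_lowr _ _ obs_coder0).
rewrite (ptens_pcomp_lowl _ _ obs_coder0).
rewrite pcomp_lowl // Phi0 def_comul0 def_coder0.
have -> : Delta \ol (psi \ol Phi n) =
    tmap psi (idl C) \ol (Delta \ol Phi n) +
    tmap (idl C) psi \ol (Delta \ol Phi n).
  by rewrite -complA coder_mapP complDl !complA.
exact: addr_cancel4.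
Qed.

Lemma obs_cocycle : coder_d P 2 (E, G) = 0.
Proof.
congr pair; rewrite ?(delta1E, delta2E, omega2E).
  by apply/eqP; rewrite subr_eq0 addrC obs_comul_lowest.
(* The sign in front of omega is (-1)^2, so the claim is delta G + omega E = 0. *)
rewrite sqrrN expr1n scale1r (addrAC _ (- _)) addrACA -opprD.
by rewrite obs_coder_lowest (addrC (_ + _) (_ + _ \ol E)) (addrC (_ \ol Delta)) subrr.
Qed.

End LowestDegree.

(** * Correcting the series degree by degree and passing to the limit *)

Lemma obs_comul_perturb Phi K n :
  Phi 0%N = idl C -> K 0%N = 0 -> (forall i, (i < n)%N -> K i = 0) ->
  obs_comul (padd Phi K) n = obs_comul Phi n + delta P 1 (K n).
Proof.
move=> Phi0 K0 Klow; rewrite delta1E /obs_comul ptensDr !ptensDl !pcompDl /padd.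
rewrite !(ptens_pcomp_lowl _ _ Klow) (ptens_pcomp_lowr _ _ Klow).
(* The quadratic term K (x) K contributes K_n (x) K_0 in degree n, which is zero. For n = 0 this
   comes from [K0], as [Klow] is then empty. *)
rewrite K0 Phi0 def_comul0 complDr opprD.
rewrite (bilin0r _ (@tmap_bilin_hom F C C C C)).
rewrite (bilin0l _ (@compl_bilin F _ _ _)) addr0.
rewrite -[X in X + _ = _]addrA [LHS]addrACA -[X in _ + X = _]addrA.
by congr (_ + _); exact: addrC.
Qed.

Lemma obs_coder_perturb Phi K n :
  Phi 0%N = idl C -> (forall i, (i < n)%N -> K i = 0) ->
  obs_coder (padd Phi K) n = obs_coder Phi n - omega P 1 (K n).
Proof.
move=> Phi0 Klow; rewrite /obs_coder pcompDl /padd (pcomp_lowl _ Klow).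
by rewrite def_coder0 omega1E complDr !opprD opprK [LHS]addrACA (addrC (_ \ol psi)).
Qed.

(** An equivalence modulo t^n, kept as a full series whose coefficients from degree n on are
    unconstrained. *)
Definition solves n Phi : Prop :=
  Phi 0%N = idl C /\
  forall i, (i < n)%N -> obs_comul Phi i = 0 /\ obs_coder Phi i = 0.

Lemma solves1 : solves 1 Id_t.
Proof.
split=> // -[] // _; split.
  rewrite /obs_comul (funext (ptens_const _ _)) tmap_id pcomp_idl def_comul0.
  have -> : Delta \ol idl C = Delta by exact: linext.
  exact: subrr.
rewrite /obs_coder pcomp_idl def_coder0.
have -> : psi \ol idl C = psi by exact: linext.
exact: subrr.
Qed.

(** Agreement below degree n makes the successive solutions converge t-adically; n > 0 keeps the
    constant coefficient equal to Id. *)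
Lemma solves_extend n Phi : (forall c : H_Coder P 2, c = 0) -> (0 < n)%N ->
  solves n Phi ->
  exists Phi', solves n.+1 Phi' /\ forall i, (i < n)%N -> Phi' i = Phi i.
Proof.
move=> /(homology_eq0P _ _).1 H2 n_gt0 [Phi0 low].
have [f df] := H2 _ (obs_cocycle Phi0 (fun i lt_in => (low i lt_in).1)
  (fun i lt_in => (low i lt_in).2)).
have dfE : delta P 1 f = obs_comul Phi n := congr1 fst df.
have dfG : - omega P 1 f = obs_coder Phi n := congr1 snd df.
(* Adding -f in degree n subtracts d(f) = (E_n, G_n) from the obstruction there and leaves lower
   degrees alone. *)
pose K : pser C C := fun i => if i == n then - f else 0.
have Kn : K n = - f by rewrite /K eqxx.
have Klow i : (i < n)%N -> K i = 0 by rewrite /K; case: ltngtP.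
exists (padd Phi K); split; last by move=> i lt_in; rewrite /padd Klow // addr0.
split; first by rewrite /padd Klow // addr0.
move=> i; rewrite ltnS => le_in.
have Klowi j : (j < i)%N -> K j = 0.
  by move=> lt_ji; apply: Klow; exact: leq_trans le_in.
rewrite obs_comul_perturb ?obs_coder_perturb //; last exact: Klow.
move: le_in; rewrite leq_eqVlt => /predU1P[->|lt_in].
  rewrite Kn (linearN (delta P 1)) (linearN (omega P 1)) -dfE -dfG.
  by rewrite subrr opprK addNr.
rewrite Klow // (linear0 (delta P 1)) (linear0 (omega P 1)) subr0 addr0.
exact: low.
Qed.

(** Degree n of a Cauchy product involves only coefficients of degree at most n; this transfers
    vanishing from the finite stages to the limit. *)
Lemma obs_local Phi Phi' n : (forall i, (i <= n)%N -> Phi i = Phi' i) ->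
  obs_comul Phi n = obs_comul Phi' n /\ obs_coder Phi n = obs_coder Phi' n.
Proof.
move=> eqPhi; rewrite /obs_comul /obs_coder (eqPhi n) //; split; congr (_ - _).
  apply: eq_bigr => i _; congr (_ \ol _); apply: eq_bigr => j _.
  have le_ij : (j <= i)%N by rewrite -ltnS.
  have le_in : (i <= n)%N by rewrite -ltnS.
  rewrite (eqPhi j) ?(eqPhi (i - j)%N) //; last exact: leq_trans le_ij le_in.
  exact: leq_trans (leq_subr _ _) le_in.
by apply: eq_bigr => i _; rewrite eqPhi // -ltnS.
Qed.

Lemma solves_all : (forall c : H_Coder P 2, c = 0) ->
  exists Phi, forall n, solves n Phi.
Proof.
move=> H2.
(* Choice requires a successor for every pair, so the property is conditional and a series that is
   not a solution is returned unchanged. The shift to n + 1 supplies positivity for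
   [solves_extend]. *)
have /choice[step stepP] (x : nat * pser C C) : exists Phi' : pser C C,
    solves x.1.+1 x.2 -> solves x.1.+2 Phi' /\
    forall i, (i <= x.1)%N -> Phi' i = x.2 i.
  case: x => n Phi /=.
  have [sol|nsol] := pselect (solves n.+1 Phi); last by exists Phi.
  by have [Phi' ?] := solves_extend H2 (ltn0Sn n) sol; exists Phi'.
pose s := nat_rect (fun=> pser C C) Id_t (fun n Phi => step (n, Phi)).
have sP n : solves n.+1 (s n).
  by elim: n => [|n /(stepP (n, s n))[]//]; exact: solves1.
have sE n i : (i <= n)%N -> s n i = s i i.
  elim: n => [|n IHn]; first by rewrite leqn0 => /eqP->.
  rewrite leq_eqVlt => /predU1P[->//|le_in].
  by rewrite -IHn //; apply: (stepP (n, s n) (sP n)).2.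
(* The diagonal is the limit: by [sE], coefficient i is constant from stage i on, so the diagonal
   agrees with [s i] up to degree i. *)
exists (fun n => s n n) => n; split=> // i _.
have [-> ->] := @obs_local (fun n => s n n) (s i) i (fun j le_ji => esym (sE _ _ le_ji)).
exact: (sP i).2.
Qed.

End Obstruction.

Theorem theorem4p2 (F : fieldType) (charF0 : [pchar F] =i pred0)
    (P : coder_pair F) :
  (forall c : H_Coder P 2, c = 0) -> rigid P.
Proof.
move=> H2 D; have [Phi Phi_sol] := solves_all D H2.
exists Phi; split=> [|n|n]; first by have [] := Phi_sol 0%N.
  (* Degree n of each equivalence equation is the vanishing of an obstruction in degree n, which
     needs a solution modulo t^(n+1). *)
  have [/subr0_eq-> _] := (Phi_sol n.+1).2 n (ltnSn n).
  by rewrite pcomp_constl.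
have [_ /subr0_eq->] := (Phi_sol n.+1).2 n (ltnSn n).
by rewrite pcomp_constl.
Qed.
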